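(* Let $k$ be an algebraically closed field, $A=kQ$ the path algebra of a finite quiver $Q$, $T$ a finite-dimensional left $A$-module, $t_i=\dim T_i$ for $i\in Q_0$, and $A[T]$ the one-point extension of $A$ by $T$. Let $\tilde M=(M,V,f:T\otimes_kV\to M)$ be an $A[T]$-module with $\tilde M_\infty\neq0$. Then $\tilde M$ is semi-stable if and only if for all subspaces $W\subseteq\tilde M_\infty$ the inequality \[ \dim M\cdot\frac{\dim W}{\dim V}\;\le\;\sum_{i\in Q_0}\dim\Big(\sum_{l=1}^{t_i}\tilde M_{\rho_{l,(i)}}(W)\Big) \] is fulfilled, and $\tilde M$ is stable if and only if for all subspaces $W\subseteq\tilde M_\infty$ the strict inequality \[ \dim M\cdot\frac{\dim W}{\dim V}\;<\;\sum_{i\in Q_0}\dim\Big(\sum_{l=1}^{t_i}\tilde M_{\rho_{l,(i)}}(W)\Big) \] is fulfilled.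
   Context: $A[T]$ is the $k$-algebra of formal matrices $\begin{pmatrix} a & t\\ 0&\lambda\end{pmatrix}$ with $a\in A$, $t\in T$, $\lambda\in k$, with componentwise addition and formal matrix multiplication. Left $A[T]$-modules are identified with triples $(M,V,f)$ where $M$ is a left $A$-module, $V$ a $k$-vector space and $f:T\otimes_kV\to M$ an $A$-module map; a morphism $(M,V,f)\to(N,W,g)$ is a pair $(\varphi_1:M\to N\text{ $A$-linear},\ \varphi_2:V\to W\text{ $k$-linear})$ with $\varphi_1f=g(\mathrm{id}_T\otimes\varphi_2)$. Write $\tilde M_\infty=V$ and $M_i=e_iM$ for $i\in Q_0$, where $e_i$ is the length $0$ path at $i$. For each $i\in Q_0$ fix a basis $\rho_{1,(i)},\dots,\rho_{t_i,(i)}$ of $T_i$; $\tilde M_{\rho_{l,(i)}}:V\to M_i$ is the linear map $v\mapsto f(\rho_{l,(i)}\otimes v)$. The slope of an $A[T]$-module is $\mu(M,V,f)=\frac{\dim V}{\dim V+\dim M}$. An $A[T]$-module $\tilde M$ is semi-stable (resp. stable) if $\mu(U)\le\mu(\tilde M)$ (resp. $\mu(U)<\mu(\tilde M)$) for all proper subrepresentations $0\neq U\subset\tilde M$.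
   Formalization: In the stability criterion the strict inequality is required only for subspaces W different from 0 and the whole of V; for W = 0 and W = V only the weak inequality is required, since the strict one can never hold there. *)

(* Defs.v *)
From HB Require Import structures.
From mathcomp Require Import all_boot all_order all_algebra finmap.
From mathcomp.multinomials Require Import monalg.

Set Implicit Arguments.
Unset Strict Implicit.
Unset Printing Implicit Defensive.

Import Order.TTheory GRing.Theory Num.Theory.
Import VectorInternalTheory.

Local Open Scope ring_scope.

Record quiver := Quiver {
  vertex : finType;
  arrow : finType;
  src : arrow -> vertex;
  tgt : arrow -> vertex
}.

Section Paths.
Variable Q : quiver.

(* The arrows of a path are listed in the order in which they are traversed,
   the first one leaving i. *)
Fixpoint walk (i : vertex Q) (s : seq (arrow Q)) : bool :=
  if s is a :: s' then (src a == i) && walk (tgt a) s' else true.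

Definition walk_end (i : vertex Q) (s : seq (arrow Q)) : vertex Q :=
  last i (map (@tgt Q) s).

Record qpath := QPath {
  qpath_code : vertex Q * seq (arrow Q);
  qpath_walk : walk qpath_code.1 qpath_code.2
}.

HB.instance Definition _ := [isSub for qpath_code].
HB.instance Definition _ := [Choice of qpath by <:].

Definition path_src (p : qpath) : vertex Q := (val p).1.
Definition path_arrows (p : qpath) : seq (arrow Q) := (val p).2.
Definition path_tgt (p : qpath) : vertex Q := walk_end (path_src p) (path_arrows p).

Definition trivial_path (i : vertex Q) : qpath := @QPath (i, [::]) isT.

(* Paths are composed like functions: path_comp p q is "first q, then p", so
   that left modules over the path algebra are representations of Q. It is
   None when p does not start where q ends; insub never fails here, see
   path_compP. *)
Definition path_comp (p q : qpath) : option qpath :=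
  if path_src p == path_tgt q
  then insub (path_src q, path_arrows q ++ path_arrows p) else None.

Lemma walk_cat i s1 s2 :
  walk i (s1 ++ s2) = walk i s1 && walk (walk_end i s1) s2.
Proof. by elim: s1 i => [|a s1 IH] i //=; rewrite IH andbA. Qed.

Lemma walk_end_cat i s1 s2 :
  walk_end i (s1 ++ s2) = walk_end (walk_end i s1) s2.
Proof. by rewrite /walk_end map_cat last_cat. Qed.

Variant path_comp_spec (p q : qpath) : option qpath -> Prop :=
| PathComp r of path_src p = path_tgt q & path_src r = path_src q
    & path_tgt r = path_tgt p & path_arrows r = path_arrows q ++ path_arrows p :
    path_comp_spec p q (Some r)
| PathNoComp of path_src p != path_tgt q : path_comp_spec p q None.

Lemma path_compP p q : path_comp_spec p q (path_comp p q).
Proof.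
rewrite /path_comp; case: eqVneq => [e|ne]; last exact: PathNoComp.
case: insubP => [r _ er|].
  have es : path_src r = path_src q by rewrite /path_src er.
  have ea : path_arrows r = path_arrows q ++ path_arrows p.
    by rewrite /path_arrows er.
  by constructor => //; rewrite {1}/path_tgt es ea walk_end_cat -/(path_tgt q) -e.
rewrite walk_cat (qpath_walk q) /= -/(path_tgt q) -e.
by rewrite (qpath_walk p).
Qed.

Lemma qpath_inj p q :
  path_src p = path_src q -> path_arrows p = path_arrows q -> p = q.
Proof.
move=> es ea; apply: val_inj; move: es ea; rewrite /path_src /path_arrows.
by case: (val p) (val q) => [? ?] [? ?] /= -> ->.
Qed.

Lemma path_comp_trivl i q :
  path_comp (trivial_path i) q = if i == path_tgt q then Some q else None.
Proof.
case: path_compP => [r e es _ ea|/negPf-> //].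
rewrite /path_src /= in e; rewrite e eqxx; congr Some.
by apply: qpath_inj => //; rewrite ea /= cats0.
Qed.

Lemma path_comp_trivr p i :
  path_comp p (trivial_path i) = if path_src p == i then Some p else None.
Proof.
case: path_compP => [r e es _ ea|/negPf-> //].
rewrite [path_tgt _]/= in e; rewrite {1}e eqxx; congr Some.
by apply: qpath_inj => //; rewrite es e.
Qed.

Lemma path_compA p q r :
  obind (fun x => path_comp p x) (path_comp q r)
  = obind (fun x => path_comp x r) (path_comp p q).
Proof.
case: (path_compP q r) => [x e es et ea|ne] /=;
  case: (path_compP p q) => [y e' es' et' ea'|ne'] //=.
- case: path_compP => [z f fs ft fa|]; last by rewrite et e' eqxx.
  case: path_compP => [z' f' fs' ft' fa'|]; last by rewrite es' e eqxx.
  congr Some; apply: qpath_inj; first by rewrite fs es fs'.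
  by rewrite fa ea fa' ea' catA.
- by case: path_compP => // z f; move: ne'; rewrite -et f eqxx.
- by case: path_compP => // z f; move: ne; rewrite -es' f eqxx.
Qed.

End Paths.

Definition path_algebra (k : fieldType) (Q : quiver) : Type :=
  {malg k[qpath Q]}.

Section PathAlgebra.
Variables (k : fieldType) (Q : quiver).
Local Notation A := (path_algebra k Q).
Implicit Types (a b c : A) (p q r : qpath Q).

HB.instance Definition _ := GRing.Lmodule.on A.

Definition path_elt p : A := << p >>.

Definition path_elt_mul p q : A := oapp path_elt 0 (path_comp p q).

Definition path_alg_mul a b : A :=
  \sum_(p <- msupp a) \sum_(q <- msupp b) (a@_p * b@_q) *: path_elt_mul p q.

Definition idem (i : vertex Q) : A := path_elt (trivial_path i).

Definition path_alg_one : A := \sum_i idem i.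

Local Open Scope fset_scope.

Lemma path_alg_mulw (d1 d2 : {fset qpath Q}) a b :
  msupp a `<=` d1 -> msupp b `<=` d2 ->
  path_alg_mul a b
  = \sum_(p <- d1) \sum_(q <- d2) (a@_p * b@_q) *: path_elt_mul p q.
Proof.
move=> le1 le2; rewrite /path_alg_mul (big_fset_incl _ le1) /=.
  apply/eq_bigr=> p _; apply/big_fset_incl => // q _ /mcoeff_outdom ->.
  by rewrite mulr0 scale0r.
move=> p _ /mcoeff_outdom h; rewrite big1 // => q _.
by rewrite h mul0r scale0r.
Qed.

Lemma msupp_lin (x : k) a b : msupp (x *: a + b) `<=` msupp a `|` msupp b.
Proof.
apply: fsubset_trans (msuppD_le _ _) _.
by apply: fsetSU; apply: msuppZ_le.
Qed.

Lemma path_alg_mul_linl b : linear (path_alg_mul^~ b).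
Proof.
move=> x a a'.
pose d := msupp a `|` msupp a'.
rewrite (path_alg_mulw (msupp_lin x a a') (fsubset_refl (msupp b))).
rewrite (path_alg_mulw (fsubsetUl (msupp a) (msupp a')) (fsubset_refl (msupp b))).
rewrite (path_alg_mulw (fsubsetUr (msupp a) (msupp a')) (fsubset_refl (msupp b))).
rewrite scaler_sumr -big_split /=; apply: eq_bigr => p _.
rewrite scaler_sumr -big_split /=; apply: eq_bigr => q _.
by rewrite mcoeffD mcoeffZ mulrDl scalerDl scalerA mulrA.
Qed.

Lemma path_alg_mul_linr a : linear (path_alg_mul a).
Proof.
move=> x b b'.
rewrite (path_alg_mulw (fsubset_refl (msupp a)) (msupp_lin x b b')).
rewrite (path_alg_mulw (fsubset_refl (msupp a)) (fsubsetUl (msupp b) (msupp b'))).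
rewrite (path_alg_mulw (fsubset_refl (msupp a)) (fsubsetUr (msupp b) (msupp b'))).
rewrite scaler_sumr -big_split /=; apply: eq_bigr => p _.
rewrite scaler_sumr -big_split /=; apply: eq_bigr => q _.
by rewrite mcoeffD mcoeffZ mulrDr scalerDl scalerA mulrCA.
Qed.

Lemma path_alg_mul_elt p q :
  path_alg_mul (path_elt p) (path_elt q) = path_elt_mul p q.
Proof.
rewrite (path_alg_mulw msuppU_le msuppU_le) !big_seq_fset1 !mcoeffUU.
by rewrite mulr1 scale1r.
Qed.

Lemma path_algE a : a = \sum_(p <- msupp a) a@_p *: path_elt p.
Proof.
rewrite {1}[a]monalgE; apply: eq_bigr => p _; apply/malgP => q.
by rewrite mcoeffZ !mcoeffU mulr_natr.
Qed.

(* Two linear maps that agree on paths are equal. *)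
Lemma path_alg_ext (U : lmodType k) (f g : A -> U) :
  linear f -> linear g -> (forall p, f (path_elt p) = g (path_elt p)) ->
  f =1 g.
Proof.
move=> lf lg fg a.
pose f' : {linear A -> U} := HB.pack f (GRing.isLinear.Build _ _ _ _ f lf).
pose g' : {linear A -> U} := HB.pack g (GRing.isLinear.Build _ _ _ _ g lg).
change (f' a = g' a); rewrite [a]path_algE !linear_sum; apply: eq_bigr => p _.
by rewrite !linearZ /= fg.
Qed.

Lemma path_alg_mul0l b : path_alg_mul 0 b = 0.
Proof. by rewrite /path_alg_mul msupp0 big_seq_fset0. Qed.

Lemma path_alg_mul0r a : path_alg_mul a 0 = 0.
Proof.
by rewrite /path_alg_mul msupp0 big1 // => p _; rewrite big_seq_fset0.
Qed.

Lemma path_alg_mulDl : left_distributive path_alg_mul +%R.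
Proof. by move=> a b c; have := path_alg_mul_linl c 1 a b; rewrite !scale1r. Qed.

Lemma path_alg_mulDr : right_distributive path_alg_mul +%R.
Proof. by move=> a b c; have := path_alg_mul_linr a 1 b c; rewrite !scale1r. Qed.

Lemma path_alg_scaleAl x a b :
  path_alg_mul (x *: a) b = x *: path_alg_mul a b.
Proof.
by have := path_alg_mul_linl b x a 0; rewrite !addr0 path_alg_mul0l addr0.
Qed.

Lemma path_alg_scaleAr x a b :
  path_alg_mul a (x *: b) = x *: path_alg_mul a b.
Proof.
by have := path_alg_mul_linr a x b 0; rewrite !addr0 path_alg_mul0r addr0.
Qed.

Lemma path_alg_mul_eltA p q r :
  path_alg_mul (path_elt p) (path_alg_mul (path_elt q) (path_elt r))
  = path_alg_mul (path_alg_mul (path_elt p) (path_elt q)) (path_elt r).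
Proof.
rewrite !path_alg_mul_elt /path_elt_mul.
transitivity (oapp path_elt 0 (obind (fun x => path_comp p x) (path_comp q r))).
  by case: (path_comp q r) => [x|] /=; rewrite ?path_alg_mul_elt ?path_alg_mul0r.
rewrite path_compA.
by case: (path_comp p q) => [x|] /=; rewrite ?path_alg_mul_elt ?path_alg_mul0l.
Qed.

Lemma path_alg_mulA : associative path_alg_mul.
Proof.
move=> a b c; pattern a; move: a; apply: path_alg_ext.
- exact: path_alg_mul_linl.
- by move=> x a a'; rewrite !path_alg_mul_linl.
move=> p; move: b; apply: path_alg_ext.
- by move=> x b b'; rewrite path_alg_mul_linl path_alg_mul_linr.
- by move=> x b b'; rewrite path_alg_mul_linr path_alg_mul_linl.
move=> q; move: c; apply: path_alg_ext.
- by move=> x c c'; rewrite !path_alg_mul_linr.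
- exact: path_alg_mul_linr.
by move=> r; apply: path_alg_mul_eltA.
Qed.

Lemma path_alg_mul1l : left_id path_alg_one path_alg_mul.
Proof.
apply: path_alg_ext => [|//|q]; first exact: path_alg_mul_linr.
rewrite /path_alg_one (big_morph (path_alg_mul^~ (path_elt q)) (id1 := 0)
  (op1 := +%R)) => [|a b|]; rewrite ?path_alg_mul0l ?path_alg_mulDl //.
rewrite (bigD1 (path_tgt q)) //= big1 => [|i /negPf ni];
  by rewrite path_alg_mul_elt /path_elt_mul path_comp_trivl ?eqxx ?ni /= ?addr0.
Qed.

Lemma path_alg_mul1r : right_id path_alg_one path_alg_mul.
Proof.
apply: path_alg_ext => [|//|p]; first exact: path_alg_mul_linl.
rewrite /path_alg_one (big_morph (path_alg_mul (path_elt p)) (id1 := 0)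
  (op1 := +%R)) => [|a b|]; rewrite ?path_alg_mul0r ?path_alg_mulDr //.
rewrite (bigD1 (path_src p)) //= big1 => [|i /negPf ni];
  by rewrite path_alg_mul_elt /path_elt_mul path_comp_trivr ?eqxx
     1?[_ == i]eq_sym ?ni /= ?addr0.
Qed.

(* If Q has no vertices then 1 = 0, so only a possibly-zero ring structure is
   available, and the compatibility with scaling is stated separately below. *)
HB.instance Definition _ := GRing.Zmodule_isPzRing.Build A
  path_alg_mulA path_alg_mul1l path_alg_mul1r path_alg_mulDl path_alg_mulDr.

Lemma path_algebra_scalerAl (x : k) a b : x *: (a * b) = (x *: a) * b.
Proof. by rewrite /GRing.mul /= path_alg_scaleAl. Qed.

Lemma path_algebra_scalerAr (x : k) a b : x *: (a * b) = a * (x *: b).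
Proof. by rewrite /GRing.mul /= path_alg_scaleAr. Qed.

Lemma sum_idem : \sum_i idem i = 1 :> A.
Proof. by []. Qed.

Lemma mul_idem i j : idem i * idem j = if i == j then idem i else 0.
Proof.
rewrite /GRing.mul /= path_alg_mul_elt /path_elt_mul path_comp_trivl.
rewrite (_ : path_tgt (trivial_path j) = j) //.
by case: eqVneq => [->|].
Qed.

End PathAlgebra.

(* A finite-dimensional left module over the path algebra, given by the
   k-algebra morphism from kQ to the endomorphisms of the underlying space. *)
Record pmodule (k : fieldType) (Q : quiver) := PModule {
  pm_space :> vectType k;
  act : path_algebra k Q -> 'End(pm_space);
  act_linear : linear act;
  act1 : act 1 = \1%VF;
  actM : forall a b, act (a * b) = (act a \o act b)%VF
}.

(* e_i M *)
Definition component (k : fieldType) (Q : quiver) (M : pmodule k Q)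
    (i : vertex Q) : {vspace M} :=
  limg (act M (idem k i)).

(* The tensor product of two finite-dimensional spaces, as coordinate matrices
   with respect to the canonical bases of T and V; tensor_univ is its universal
   property. *)
Section Tensor.
Variable k : fieldType.

Definition tensor (T V : vectType k) : vectType k := 'M[k]_(dim T, dim V).

Definition tens (T V : vectType k) (t : T) (v : V) : tensor T V :=
  (v2r t)^T *m v2r v.

(* g \otimes id_V *)
Definition tensor_mapl (T T' V : vectType k) (g : 'Hom(T, T'))
    (x : tensor T V) : tensor T' V :=
  (f2mx g)^T *m x.

Lemma tensor_mapl_tens (T T' V : vectType k) (g : 'Hom(T, T')) (t : T) (v : V) :
  tensor_mapl g (tens t v) = tens (g t) v.
Proof.
rewrite /tensor_mapl /tens unlock /= mulmxA -trmx_mul.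
by rewrite /fun_of_lfun_def /= r2vK.
Qed.

Lemma tens_linear (T V : vectType k) (t : T) : linear (@tens T V t).
Proof. by move=> x v w; rewrite /tens linearP linearP. Qed.

HB.instance Definition _ (T V : vectType k) (t : T) :=
  GRing.isLinear.Build k V (tensor T V) _ (@tens T V t) (@tens_linear T V t).

Lemma tens_linearl (T V : vectType k) (v : V) : linear (fun t : T => tens t v).
Proof.
by move=> x t u; rewrite /tens !linearP /= mulmxDl scalemxAl.
Qed.

Lemma tensorE (T V : vectType k) (x : tensor T V) :
  x = \sum_i \sum_j
        x i j *: tens (r2v (delta_mx 0 i) : T) (r2v (delta_mx 0 j) : V).
Proof.
rewrite {1}[x]matrix_sum_delta; apply: eq_bigr => i _; apply: eq_bigr => j _.
by rewrite /tens !r2vK trmx_delta mul_delta_mx.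
Qed.

Lemma tensor_univ (T V U : vectType k) (b : T -> V -> U) :
  (forall t, linear (b t)) -> (forall v, linear (b^~ v)) ->
  exists! h : 'Hom(tensor T V, U), forall t v, h (tens t v) = b t v.
Proof.
move=> lr ll.
pose h0 (x : tensor T V) : U :=
  \sum_i \sum_j x i j *: b (r2v (delta_mx 0 i)) (r2v (delta_mx 0 j)).
have h0lin : linear h0.
  move=> c x y; rewrite /h0 scaler_sumr -big_split; apply: eq_bigr => i _ /=.
  rewrite scaler_sumr -big_split; apply: eq_bigr => j _ /=.
  by rewrite !mxE scalerDl scalerA.
pose h : {linear tensor T V -> U} :=
  HB.pack h0 (GRing.isLinear.Build _ _ _ _ h0 h0lin).
exists (linfun h); split=> [t v|h' hh']; last first.
  apply/lfunP => x; rewrite lfunE /= /h0 [in RHS](tensorE x) linear_sum.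
  apply: eq_bigr => i _; rewrite linear_sum; apply: eq_bigr => j _.
  by rewrite linearZ /= hh'.
rewrite lfunE /= /h0.
pose bt : {linear V -> U} := HB.pack (b t) (GRing.isLinear.Build _ _ _ _ (b t) (lr t)).
have rowE (X : vectType k) (x : X) :
    x = \sum_i v2r x 0 i *: r2v (delta_mx 0 i).
  rewrite -[LHS]v2rK [in LHS](row_sum_delta (v2r x)) linear_sum.
  by apply: eq_bigr => i _; rewrite linearZ.
rewrite {2}[t]rowE.
pose bl (w : V) : {linear T -> U} :=
  HB.pack (b^~ w) (GRing.isLinear.Build _ _ _ _ (b^~ w) (ll w)).
change (\sum_i \sum_j tens t v i j *: b (r2v (delta_mx 0 i)) (r2v (delta_mx 0 j))
  = bl v (\sum_i v2r t 0 i *: r2v (delta_mx 0 i))).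
rewrite linear_sum; apply: eq_bigr => i _; rewrite linearZ /=.
pose bi : {linear V -> U} := HB.pack (b (r2v (delta_mx 0 i)))
  (GRing.isLinear.Build _ _ _ _ _ (lr (r2v (delta_mx 0 i)))).
rewrite {2}[v]rowE.
change (\sum_j tens t v i j *: b (r2v (delta_mx 0 i)) (r2v (delta_mx 0 j))
  = v2r t 0 i *: bi (\sum_j v2r v 0 j *: r2v (delta_mx 0 j))).
rewrite linear_sum scaler_sumr; apply: eq_bigr => j _; rewrite linearZ /=.
by rewrite scalerA /tens mxE big_ord1 mxE.
Qed.

End Tensor.

(* A (finite-dimensional) left module (M, V, f) over the one-point extension
   kQ[T]; kQ acts on the tensor product of T and V through T. *)
Record opmodule (k : fieldType) (Q : quiver) (T : pmodule k Q) := OPModule {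
  op_mod : pmodule k Q;
  op_inf : vectType k;
  op_map : 'Hom(tensor T op_inf, op_mod);
  op_mapA : forall (a : path_algebra k Q) (x : tensor T op_inf),
    op_map (tensor_mapl (act T a) x) = act op_mod a (op_map x)
}.

Section Stability.
Variables (k : fieldType) (Q : quiver) (T : pmodule k Q) (M : opmodule T).
Local Notation M0 := (op_mod M).
Local Notation V := (op_inf M).

(* v |-> f (rho \otimes v) *)
Definition op_arrow (rho : T) : 'Hom(V, M0) := (op_map M \o linfun (tens rho))%VF.

(* The pair (N, W) is a subrepresentation: N is a kQ-submodule of M containing
   the image under f of the tensor product of T and W. *)
Definition subrep (N : {vspace M0}) (W : {vspace V}) : Prop :=
  (forall (a : path_algebra k Q) (x : M0), x \in N -> act M0 a x \in N) /\
  (forall (t : T) (w : V), w \in W -> op_map M (tens t w) \in N).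

Definition slope (dM dV : nat) : rat := dV%:R / (dV + dM)%:R.

Definition op_slope : rat := slope (\dim {:M0}) (\dim {:V}).

Definition proper_subrep (N : {vspace M0}) (W : {vspace V}) : Prop :=
  [/\ subrep N W, ~ (N = 0%VS /\ W = 0%VS) & ~ (N = fullv /\ W = fullv)].

Definition semistable : Prop :=
  forall N W, proper_subrep N W -> slope (\dim N) (\dim W) <= op_slope.

Definition stable : Prop :=
  forall N W, proper_subrep N W -> slope (\dim N) (\dim W) < op_slope.

End Stability.

(* Main.v *)
Require Import Defs.
From HB Require Import structures.
From mathcomp Require Import all_boot all_order all_algebra.

(** A subrepresentation (N, W) of (M, V, f) must contain f(T (x) W), and the
    slope of (N, W) does not increase when N grows. So among the subrepresentations
    with a given W at the extending vertex the worst one is (f(T (x) W), W),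
    which is a subrepresentation because f is A-linear ([gen_subrep],
    [gen_sub]), and it is enough to test the slope on these. Clearing
    denominators in mu(f(T (x) W), W) <= mu(M, V) gives
    dim M * dim W <= dim f(T (x) W) * dim V ([slope_le], [ratio_le]).

    It remains to compute dim f(T (x) W). The orthogonal idempotents e_i
    decompose T into the T_i and M into the M_i, and f maps T_i (x) W into M_i;
    hence f(T (x) W) is the direct sum of the spaces e_i f(T (x) W), each of
    which is the sum of the images of W under the maps attached to a basis of
    T_i ([dim_gen]). This yields the right-hand side of the criterion.

    The extreme subspaces need separate treatment. For W = 0 the slope is 0,
    which is smaller than mu(M, V) because V is nonzero. For W = V the weak
    inequality says f(T (x) V) = M, that is, no proper subrepresentation
    contains V. *)

Set Implicit Arguments.
Unset Strict Implicit.
Unset Printing Implicit Defensive.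

Import Order.TTheory GRing.Theory Num.Theory.

Local Open Scope ring_scope.

(** Cross-multiplying the slopes, the terms w * v cancel. *)
Lemma slope_le (n w m v : nat) : (0 < w + n)%N -> (0 < v)%N ->
  (slope n w <= slope m v) = (m * w <= n * v)%N.
Proof.
move=> wn v0; have vm : (0 < v + m)%N by rewrite addn_gt0 v0.
rewrite /slope ler_pdivrMr ?ltr0n // mulrAC ler_pdivlMr ?ltr0n //.
by rewrite -!natrM ler_nat !mulnDr [(w * v)%N]mulnC leq_add2l mulnC [(v * n)%N]mulnC.
Qed.

Lemma slope_lt (n w m v : nat) : (0 < w + n)%N -> (0 < v)%N ->
  (slope n w < slope m v) = (m * w < n * v)%N.
Proof.
move=> wn v0; have vm : (0 < v + m)%N by rewrite addn_gt0 v0.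
rewrite /slope ltr_pdivrMr ?ltr0n // mulrAC ltr_pdivlMr ?ltr0n //.
by rewrite -!natrM ltr_nat !mulnDr [(w * v)%N]mulnC ltn_add2l mulnC [(v * n)%N]mulnC.
Qed.

Lemma ratio_le (n w m v : nat) : (0 < v)%N ->
  (m%:R * (w%:R / v%:R) <= n%:R :> rat) = (m * w <= n * v)%N.
Proof. by move=> v0; rewrite mulrA ler_pdivrMr ?ltr0n // -!natrM ler_nat. Qed.

Lemma ratio_lt (n w m v : nat) : (0 < v)%N ->
  (m%:R * (w%:R / v%:R) < n%:R :> rat) = (m * w < n * v)%N.
Proof. by move=> v0; rewrite mulrA ltr_pdivrMr ?ltr0n // -!natrM ltr_nat. Qed.

Section PModule.
Variables (k : fieldType) (Q : quiver) (M : pmodule k Q).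

Lemma act0 : act M 0 = 0.
Proof. by have := act_linear M (-1) 0 0; rewrite scaler0 addr0 scaleN1r addNr. Qed.

Lemma act_sum (I : finType) (a : I -> path_algebra k Q) :
  act M (\sum_i a i) = \sum_i act M (a i).
Proof.
apply: (big_morph (act M)) => [a1 a2|]; last exact: act0.
by have := act_linear M 1 a1 a2; rewrite !scale1r.
Qed.

Lemma act_idem_sum (x : M) : x = \sum_i act M (idem k i) x.
Proof. by rewrite -sum_lfunE -act_sum sum_idem act1 id_lfunE. Qed.

Lemma act_component i j (x : M) : x \in component M j ->
  act M (idem k i) x = if i == j then x else 0.
Proof.
case/memv_imgP => y _ ->; rewrite -comp_lfunE -actM mul_idem.
by case: eqVneq => [->|_] //; rewrite act0 zero_lfunE.
Qed.

Lemma act_idem_component i (x : M) : act M (idem k i) x \in component M i.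
Proof. by rewrite memv_img ?memvf. Qed.

(** Applying e_i to a sum of vectors of the M_j isolates the summand in M_i. *)
Lemma dim_sum_component (U : vertex Q -> {vspace M}) :
  (forall i, U i <= component M i)%VS ->
  (\dim (\sum_i U i)%VS = \sum_i \dim (U i))%N.
Proof.
move=> sU; apply/directvP/directv_sum_independent => u uU u0 i _.
have := congr1 (act M (idem k i)) u0; rewrite linear0 linear_sum /=.
rewrite (bigD1 i) //= big1 ?addr0 => [|j /negPf nij].
  by rewrite (act_component _ (subvP (sU i) _ (uU i isT))) eqxx.
by rewrite (act_component _ (subvP (sU j) _ (uU j isT))) eq_sym nij.
Qed.

End PModule.

Section Generated.
Variables (k : fieldType) (Q : quiver) (T : pmodule k Q).
Variable rho : forall i : vertex Q, (\dim (component T i)).-tuple T.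
Hypothesis rho_basis : forall i : vertex Q, basis_of (component T i) (rho i).
Variable M : opmodule T.
Local Notation M0 := (op_mod M).
Implicit Types (W : {vspace op_inf M}) (N : {vspace M0}).

Definition gen_at W (i : vertex Q) : {vspace M0} :=
  (\sum_(l < \dim (component T i)) (op_arrow M (tnth (rho i) l) @: W))%VS.

(** This is f(T (x) W), written by means of the bases of the T_i so that its
    dimension can be read off; [mem_gen] and [gen_sub] identify it. *)
Definition gen W : {vspace M0} := (\sum_i gen_at W i)%VS.

Lemma op_arrowE (t : T) v : op_arrow M t v = op_map M (tens t v).
Proof. by rewrite /op_arrow comp_lfunE lfunE. Qed.

Lemma act_op_arrow a (t : T) v :
  act M0 a (op_arrow M t v) = op_arrow M (act T a t) v.
Proof. by rewrite !op_arrowE -op_mapA tensor_mapl_tens. Qed.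

Lemma tens0l (v : op_inf M) : tens (0 : T) v = 0.
Proof.
by have := tens_linearl v (-1) (0 : T) 0; rewrite scaler0 addr0 scaleN1r addNr.
Qed.

Lemma op_arrow_sum (I : finType) (t : I -> T) v :
  op_arrow M (\sum_i t i) v = \sum_i op_arrow M (t i) v.
Proof.
apply: (big_morph (fun t => op_arrow M t v)) => [t1 t2|]; rewrite !op_arrowE.
  by have := tens_linearl v 1 t1 t2; rewrite !scale1r => ->; rewrite linearD.
by rewrite tens0l linear0.
Qed.

Lemma op_arrowZ c (t : T) v : op_arrow M (c *: t) v = op_arrow M t (c *: v).
Proof.
rewrite !op_arrowE linearZ /=.
by have := tens_linearl v c t 0; rewrite tens0l !addr0 => ->; rewrite !linearZ.
Qed.

Lemma mem_gen_at W i (t : T) w : t \in component T i -> w \in W ->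
  op_arrow M t w \in gen_at W i.
Proof.
move=> ti wW; rewrite (coord_basis (rho_basis i) ti) op_arrow_sum.
apply: memv_sumr => l _; rewrite op_arrowZ -tnth_nth.
by rewrite memv_img // memvZ.
Qed.

Lemma mem_gen W (t : T) w : w \in W -> op_arrow M t w \in gen W.
Proof.
move=> wW; rewrite (act_idem_sum t) op_arrow_sum.
by apply: memv_sumr => i _; rewrite mem_gen_at ?act_idem_component.
Qed.

Lemma gen_subrep W : subrep (gen W) W.
Proof.
split=> [a x|t w wW]; last by rewrite -op_arrowE mem_gen.
suff sg : (act M0 a @: gen W <= gen W)%VS.
  by move=> xg; apply: (subvP sg); apply: memv_img.
rewrite /gen limg_sum; apply/subv_sumP => i _.
rewrite limg_sum; apply/subv_sumP => l _; apply/subvP => y.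
case/memv_imgP => _ /memv_imgP [w wW ->] ->.
by rewrite act_op_arrow mem_gen.
Qed.

Lemma gen_sub N W : subrep N W -> (gen W <= N)%VS.
Proof.
case=> _ fN; apply/subv_sumP => i _; apply/subv_sumP => l _.
by apply/subvP => _ /memv_imgP [w wW ->]; rewrite op_arrowE fN.
Qed.

(** Since e_i rho = rho for rho in T_i and f is A-linear, f(rho (x) w) is fixed
    by e_i. *)
Lemma gen_at_component W i : (gen_at W i <= component M0 i)%VS.
Proof.
apply/subv_sumP => l _; apply/subvP => _ /memv_imgP [w wW ->].
have rl : tnth (rho i) l \in component T i.
  by apply: (basis_mem (rho_basis i)); apply: mem_tnth.
have := act_component i rl; rewrite eqxx => <-.
by rewrite -act_op_arrow act_idem_component.
Qed.

Lemma dim_gen W : \dim (gen W) = (\sum_i \dim (gen_at W i))%N.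
Proof. exact: dim_sum_component (gen_at_component W). Qed.

Hypothesis Minf_neq0 : \dim {: op_inf M} <> 0%N.

Let Minf_gt0 : (0 < \dim {: op_inf M})%N.
Proof. by rewrite lt0n; apply/eqP. Qed.

Lemma proper_dim_gt0 N W : proper_subrep N W -> (0 < \dim W + \dim N)%N.
Proof.
case=> _ n0 _; rewrite lt0n addn_eq0 !dimv_eq0.
by apply/andP => -[/eqP W0 /eqP N0]; apply: n0.
Qed.

(** Replacing N by the smaller f(T (x) W) only raises the slope, so testing the
    pairs (f(T (x) W), W) suffices. When such a pair is zero or the whole of M,
    it is not covered by semi-stability, but then the inequality is trivial. *)
Lemma semistable_gen : semistable M <->
  forall W, (\dim {: M0} * \dim W <= \dim (gen W) * \dim {: op_inf M})%N.
Proof.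
split=> [ssM W|gM N W pNW].
  have [->|/eqP W0] := eqVneq W 0%VS; first by rewrite dimv0 muln0.
  have [/andP[/eqP -> /eqP ->]|nf] := boolP ((gen W == fullv) && (W == fullv)).
    by [].
  have pW : proper_subrep (gen W) W.
    split=> [|[_ //]|[gf Wf]]; first exact: gen_subrep.
    by rewrite gf Wf !eqxx in nf.
  by rewrite -slope_le ?proper_dim_gt0 //; apply: ssM.
rewrite /op_slope slope_le ?proper_dim_gt0 //.
apply: leq_trans (gM W) _; rewrite leq_mul2r dimvS ?orbT //.
by apply: gen_sub; case: pNW.
Qed.

(** Strictness is asked only for W different from 0 and V. At W = V stability
    amounts to f(T (x) V) = M, which the weak inequality expresses. *)
Lemma stable_gen : stable M <->
  forall W, (\dim {: M0} * \dim W <= \dim (gen W) * \dim {: op_inf M})%N /\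
    (W <> 0%VS -> W <> fullv ->
     \dim {: M0} * \dim W < \dim (gen W) * \dim {: op_inf M})%N.
Proof.
split=> [sM W|gM N W pNW].
  split=> [|W0 Wf].
    by apply: (proj1 semistable_gen) => N' W' /sM /ltW.
  have pW : proper_subrep (gen W) W.
    by split=> [|[]|[]] //; apply: gen_subrep.
  by rewrite -slope_lt ?proper_dim_gt0 //; apply: sM.
rewrite /op_slope slope_lt ?proper_dim_gt0 //.
have [sNW N0 Nf] := pNW; have gN := dimvS (gen_sub sNW).
have [WV|/eqP Wf] := eqVneq W fullv.
  (* The weak inequality for W = V forces f(T (x) V) = M, hence N = M. *)
  have [gV _] := gM W; rewrite {1}WV leq_pmul2r // in gV.
  case: Nf; split=> //; apply/eqP.
  by rewrite eqEdim subvf (leq_trans gV gN).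
have [W0|/eqP W0] := eqVneq W 0%VS.
  rewrite W0 dimv0 muln0 muln_gt0 Minf_gt0 andbT lt0n dimv_eq0.
  by apply/eqP => N_0; apply: N0.
have [_ gW] := gM W; apply: leq_trans (gW W0 Wf) _.
by rewrite leq_mul2r gN orbT.
Qed.

End Generated.

(* In the second equivalence the strict inequality is required for the nonzero
   proper subspaces only: for W = 0 and for W = V the strict inequality can
   never hold (0 < 0, resp. dim M < dim of a subspace of M), so the weak one is
   what is required there. *)
Theorem theorem5p2 (k : closedFieldType) (Q : quiver) (T : pmodule k Q)
    (rho : forall i : vertex Q, (\dim (component T i)).-tuple T)
    (rho_basis : forall i : vertex Q, basis_of (component T i) (rho i))
    (M : opmodule T) (Minf_neq0 : \dim {: op_inf M} <> 0%N) :
  (semistable M <->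
     forall W : {vspace op_inf M},
       (\dim {: op_mod M})%:R * ((\dim W)%:R / (\dim {: op_inf M})%:R)
       <= (\sum_(i : vertex Q)
             \dim (\sum_(l < \dim (component T i))
                     (op_arrow M (tnth (rho i) l) @: W))%VS)%:R :> rat)
  /\
  (stable M <->
     forall W : {vspace op_inf M},
       ((\dim {: op_mod M})%:R * ((\dim W)%:R / (\dim {: op_inf M})%:R)
        <= (\sum_(i : vertex Q)
              \dim (\sum_(l < \dim (component T i))
                      (op_arrow M (tnth (rho i) l) @: W))%VS)%:R :> rat)
       /\
       (W <> 0%VS -> W <> fullv ->
        (\dim {: op_mod M})%:R * ((\dim W)%:R / (\dim {: op_inf M})%:R)
        < (\sum_(i : vertex Q)
              \dim (\sum_(l < \dim (component T i))
                      (op_arrow M (tnth (rho i) l) @: W))%VS)%:R :> rat)).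
Proof.
have V0 : (0 < \dim {: op_inf M})%N by rewrite lt0n; apply/eqP.
split.
  apply: (iff_trans (semistable_gen rho_basis Minf_neq0)).
  by split=> gM W; have := gM W; rewrite ratio_le // (dim_gen rho_basis).
apply: (iff_trans (stable_gen rho_basis Minf_neq0)).
by split=> gM W; have := gM W; rewrite ratio_le // ratio_lt // (dim_gen rho_basis).
Qed.
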